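(* Let $K$ be a field and $I\subset S=K[x_1,\ldots,x_n]$ a graded ideal generated in degree $d$. Suppose there is an integer $k_0$ such that $I^k$ has a linear resolution for all $k\geq k_0$. Then $\operatorname{depth} I^k\geq \operatorname{depth} I^{k+1}$ for all $k\geq k_0$.
   Context: $S$ carries the standard grading. A graded ideal $J$ generated in degree $e$ has a linear resolution if $\operatorname{Tor}^S_i(K,J)_{i+j}=0$ for all $i$ and all $j\neq e$. Depth is taken with respect to the graded maximal ideal $(x_1,\ldots,x_n)$. *)

(* Defs.v *)
From mathcomp Require Import all_boot all_order all_algebra.
From mathcomp Require Export mpoly.
From Stdlib Require Import Classical ClassicalEpsilon.

Set Implicit Arguments.
Unset Strict Implicit.
Unset Printing Implicit Defensive.

Import GRing.Theory.
Local Open Scope ring_scope.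

(* Ideals are Prop-valued predicates and may be the whole ring: the bool-valued
   [idealr] structure of MathComp only covers proper ideals with a decision
   procedure for membership. *)
Section Ideals.

Variable R : comNzRingType.

Definition is_ideal (J : R -> Prop) : Prop :=
  [/\ J 0, forall f g, J f -> J g -> J (f + g)
    & forall h f, J f -> J (h * f)].

Definition ideal_gen (A : R -> Prop) : R -> Prop := fun f =>
  exists2 s : seq (R * R),
    forall x, x \in s -> A x.2 & f = \sum_(x <- s) x.1 * x.2.

Definition ideal_mul (I J : R -> Prop) : R -> Prop :=
  ideal_gen (fun h => exists f g, [/\ I f, J g & h = f * g]).

Fixpoint ideal_pow (I : R -> Prop) (k : nat) : R -> Prop :=
  if k is k'.+1 then ideal_mul I (ideal_pow I k') else fun=> True.

Definition seq_ideal (s : seq R) : R -> Prop := ideal_gen (fun f => f \in s).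

(* An ideal J is viewed as an R-module; its submodule (s)J is the product of
   ideals. Besides each s_i being a nonzerodivisor on J/(s_0,...,s_{i-1})J, the
   quotient J/(s)J has to be nonzero. *)
Definition regular_seq (J : R -> Prop) (s : seq R) : Prop :=
  (forall i u, (i < size s)%N -> J u ->
     ideal_mul (seq_ideal (take i s)) J (s`_i * u) ->
     ideal_mul (seq_ideal (take i s)) J u) /\
  (exists2 u, J u & ~ ideal_mul (seq_ideal s) J u).

Definition regular_seq_in (m J : R -> Prop) (s : seq R) : Prop :=
  (forall f, f \in s -> m f) /\ regular_seq J s.

(* [None] stands for infinity. The m-depth of J is infinite when mJ = J (for
   instance when J = 0), and otherwise it is the supremum of the lengths of the
   J-regular sequences with entries in m. *)
Definition is_depth (m J : R -> Prop) (v : option nat) : Prop :=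
  match v with
  | Some r =>
    [/\ exists2 u, J u & ~ ideal_mul m J u,
        exists2 s, regular_seq_in m J s & size s = r
      & forall s, regular_seq_in m J s -> (size s <= r)%N]
  | None =>
    (forall u, J u -> ideal_mul m J u) \/
    (forall r, exists2 s, regular_seq_in m J s & (r <= size s)%N)
  end.

Definition depth (m J : R -> Prop) : option nat :=
  epsilon (inhabits None) (is_depth m J).

Lemma is_depth_uniq m J v w : is_depth m J v -> is_depth m J w -> v = w.
Proof.
case: v w => [r|] [t|] //=.
- move=> [_ [s1 s1P <-] max1] [_ [s2 s2P <-] max2].
  by congr Some; apply/eqP; rewrite eqn_leq max1 // max2.
- move=> [[u Ju mJu] _ rmax] [JmJ|unb]; first by case: mJu; apply: JmJ.
  by have [s sP] := unb r.+1; rewrite ltnNge rmax.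
- move=> [JmJ|unb] [[u Ju mJu] _ rmax]; first by case: mJu; apply: JmJ.
  by have [s sP] := unb t.+1; rewrite ltnNge rmax.
Qed.

Lemma seq_ideal_nil f : seq_ideal [::] f -> f = 0.
Proof.
move=> [[|x s] sP ->]; first by rewrite big_nil.
by have := sP x (mem_head _ _); rewrite in_nil.
Qed.

Lemma ideal_mul_nil J f : ideal_mul (seq_ideal [::]) J f -> f = 0.
Proof.
move=> [s sP ->]; rewrite big_seq big1 // => x /sP [g [h [g0 _ ->]]].
by rewrite (seq_ideal_nil g0) mul0r mulr0.
Qed.

Lemma depth_spec m J : is_depth m J (depth m J).
Proof.
apply: epsilon_spec.
have [JmJ|nJmJ] := classic (forall u, J u -> ideal_mul m J u).
  by exists None; left.
have [unb|] := classic
    (forall r, exists2 s, regular_seq_in m J s & (r <= size s)%N).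
  by exists None; right.
move=> /not_all_ex_not [b bP].
have {}bP s : regular_seq_in m J s -> (size s <= b)%N.
  move=> sP; rewrite leqNgt; apply/negP => lt_b.
  by apply: bP; exists s; rewrite // ltnW.
have [u Ju nmJu] : exists2 u, J u & ~ ideal_mul m J u.
  apply: NNPP => nex; apply: nJmJ => u Ju.
  by apply: NNPP => nmJu; apply: nex; exists u.
have nil_reg : regular_seq_in m J [::].
  split=> //; split=> //; exists u => // /ideal_mul_nil u0.
  by apply: nmJu; exists [::]; rewrite ?big_nil.
have attained : exists2 r, exists2 s, regular_seq_in m J s & size s = r
    & forall s, regular_seq_in m J s -> (size s <= r)%N.
  elim: b bP => [|b IHb] bP; first by exists 0%N => //; exists [::].
  have [ex|nex] := classic (exists2 s, regular_seq_in m J s & size s = b.+1).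
    by exists b.+1.
  apply: IHb => s sP; have := bP s sP; rewrite leq_eqVlt ltnS.
  by case/orP=> // /eqP size_s; case: nex; exists s.
have [r rP rmax] := attained.
by exists (Some r); split=> //; exists u.
Qed.

Lemma is_depthP m J v : is_depth m J v <-> depth m J = v.
Proof.
split=> [vP|<-]; last exact: depth_spec.
exact: is_depth_uniq (depth_spec m J) vP.
Qed.

End Ideals.

Definition depth_le (v w : option nat) : bool :=
  match v, w with
  | _, None => true
  | None, Some _ => false
  | Some a, Some b => (a <= b)%N
  end.

Section Graded.

Variables (K : fieldType) (n : nat).
Local Notation S := {mpoly K[n]}.

Definition homog_int (e : int) (f : S) : bool :=
  match e with
  | Posz d => f \is d.-homog
  | Negz _ => f == 0
  end.

Definition graded_ideal (J : S -> Prop) : Prop :=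
  is_ideal J /\ forall f d, J f -> J (pihomog mdeg d f).

Definition generated_in_degree (d : nat) (J : S -> Prop) : Prop :=
  forall f, J f <-> ideal_gen (fun g => J g /\ g \is d.-homog) f.

Definition irrelevant_ideal : S -> Prop :=
  ideal_gen (fun f => exists i : 'I_n, f = 'X_i).

(* The S-linear map S^r -> K = S/(x_1,...,x_n) with the given values on the
   standard basis; f@_0 is the class of f in K. *)
Definition augmentation r (c : 'cV[K]_r) (v : 'rV[S]_r) : K :=
  \sum_(l < r) (v 0 l)@_0%MM * c l 0.

(* A graded resolution ... -> F_1 -> F_0 -> K -> 0 of K by finitely generated
   graded free S-modules. The elements of F_i are row vectors of length
   [rk i], the l-th basis element of F_i has degree [dg i l], and the
   differential F_(i+1) -> F_i is right multiplication by [df i]. *)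
Record graded_free_resolution : Type := GradedFreeResolution {
  rk : nat -> nat;
  dg : forall i, 'I_(rk i) -> int;
  df : forall i, 'M[S]_(rk i.+1, rk i);
  au : 'cV[K]_(rk 0);
  df_homog : forall i k l, homog_int (dg k - dg l) (df i k l);
  au_homog : forall l, au l 0 != 0 -> dg l = 0;
  au_surj : forall a : K, exists v, augmentation au v = a;
  au_exact : forall v,
    augmentation au v = 0 <-> exists w, v = w *m df 0;
  df_exact : forall i (v : 'rV[S]_(rk i.+1)),
    v *m df i = 0 <-> exists w, v = w *m df i.+1
}.

(* F_i being free, F_i (x) J is J^(rk i); its component of degree e consists of
   the vectors whose l-th entry is in J and homogeneous of degree e - dg l. *)
Definition tensor_component (F : graded_free_resolution) (J : S -> Prop)
    (i : nat) (e : int) (v : 'rV[S]_(rk F i)) : Prop :=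
  forall l, J (v 0 l) /\ homog_int (e - dg l) (v 0 l).

Definition cycle (F : graded_free_resolution) (i : nat) :
    'rV[S]_(rk F i) -> Prop :=
  match i return 'rV[S]_(rk F i) -> Prop with
  | 0 => fun=> True
  | i'.+1 => fun v => v *m df F i' = 0
  end.

(* Tor^S_i(K, J)_e = 0, the Tor being the homology of F (x) J for a graded free
   resolution F of K; it does not depend on F. *)
Definition tor_component_eq0 (J : S -> Prop) (i : nat) (e : int) : Prop :=
  forall (F : graded_free_resolution) (v : 'rV[S]_(rk F i)),
    tensor_component J e v -> cycle v ->
    exists2 w : 'rV[S]_(rk F i.+1), tensor_component J e w & v = w *m df F i.

Definition has_linear_resolution (J : S -> Prop) : Prop :=
  exists2 e : nat, generated_in_degree e J
    & forall (i : nat) (j : int), j != e -> tor_component_eq0 J i (i%:Z + j).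

End Graded.

(* Main.v *)
Require Import Defs.
From mathcomp Require Import all_boot all_order all_algebra.
From Stdlib Require Import Classical ClassicalEpsilon.
Import Order.TTheory GRing.Theory.

Set Implicit Arguments.
Unset Strict Implicit.
Unset Printing Implicit Defensive.

Local Open Scope ring_scope.

(* Write J = I^k and let J be generated in degree e. The depth of an ideal is at
   least r iff its Koszul homology vanishes in all degrees above n - r. A cycle
   with coefficients in J splits into graded parts. As J has a linear resolution,
   a part whose coefficients have degree t <> e is a boundary. Multiplying the
   part of degree t = e by a nonzero f in I of degree d yields a cycle of
   I^(k+1); if that bounds, it is zero, because I^(k+1) lives in degrees >= d + e
   and so its boundaries have coefficients of degree > d + e. Hence vanishing of
   the Koszul homology passes from I^(k+1) to I^k.

   The field may be finite, so regular sequences are not extended by general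
   linear forms but by prime avoidance among the maximal annihilators. *)

(** * Ideals *)

Section IdealTheory.

Variable R : comNzRingType.
Implicit Types (I J N A : R -> Prop) (s t : seq R) (f g u z : R).

Lemma is_ideal0 J : is_ideal J -> J 0. Proof. by case. Qed.

Lemma is_idealD J f g : is_ideal J -> J f -> J g -> J (f + g).
Proof. by case=> _ + _; apply. Qed.

Lemma is_idealMl J h f : is_ideal J -> J f -> J (h * f).
Proof. by case=> _ _; apply. Qed.

Lemma is_idealMr J h f : is_ideal J -> J f -> J (f * h).
Proof. by rewrite mulrC; apply: is_idealMl. Qed.

Lemma is_idealN J f : is_ideal J -> J f -> J (- f).
Proof. by rewrite -mulN1r; apply: is_idealMl. Qed.

Lemma is_idealB J f g : is_ideal J -> J f -> J g -> J (f - g).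
Proof. by move=> Ji Jf Jg; apply: is_idealD => //; apply: is_idealN. Qed.

Lemma is_ideal_sum J (T : Type) (r : seq T) (P : pred T) (F : T -> R) :
  is_ideal J -> (forall i, P i -> J (F i)) -> J (\sum_(i <- r | P i) F i).
Proof.
move=> Ji JF; elim/big_ind: _ => //; first exact: is_ideal0.
by move=> f g; apply: is_idealD.
Qed.

Lemma zero_is_ideal : is_ideal (fun f : R => f = 0).
Proof. by split=> [//|f g -> ->|h f ->]; rewrite ?addr0 ?mulr0. Qed.

Lemma ideal_gen_is_ideal A : is_ideal (ideal_gen A).
Proof.
split=> [|f g [s sA ->] [t tA ->]|h f [s sA ->]].
- by exists [::]; rewrite ?big_nil.
- exists (s ++ t); last by rewrite big_cat.
  by move=> x; rewrite mem_cat => /orP[/sA|/tA].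
exists [seq (h * x.1, x.2) | x <- s]; first by move=> _ /mapP[x /sA ? ->].
by rewrite big_map mulr_sumr; apply: eq_bigr => x _; rewrite mulrA.
Qed.

Lemma seq_ideal_is_ideal s : is_ideal (seq_ideal s).
Proof. exact: ideal_gen_is_ideal. Qed.

Lemma ideal_mul_is_ideal I J : is_ideal (ideal_mul I J).
Proof. exact: ideal_gen_is_ideal. Qed.

Hint Resolve ideal_gen_is_ideal seq_ideal_is_ideal ideal_mul_is_ideal : core.

Lemma ideal_gen_self A f : A f -> ideal_gen A f.
Proof.
move=> Af; exists [:: (1, f)]; last by rewrite big_seq1 mul1r.
by move=> x; rewrite inE => /eqP ->.
Qed.

Lemma ideal_gen_min A J : is_ideal J -> (forall f, A f -> J f) ->
  forall f, ideal_gen A f -> J f.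
Proof.
move=> Ji AJ _ [s sA ->]; rewrite big_seq; apply: is_ideal_sum => // x /sA /AJ.
exact: is_idealMl.
Qed.

Lemma ideal_mulM I J f g : I f -> J g -> ideal_mul I J (f * g).
Proof. by move=> If Jg; apply: ideal_gen_self; exists f, g. Qed.

Lemma ideal_mul_min I J N : is_ideal N ->
  (forall f g, I f -> J g -> N (f * g)) -> forall u, ideal_mul I J u -> N u.
Proof.
by move=> Ni IJN; apply: ideal_gen_min => // _ [f [g [If Jg ->]]]; apply: IJN.
Qed.

Lemma ideal_pow_is_ideal I k : is_ideal I -> is_ideal (ideal_pow I k).
Proof. by case: k => [|k] _ //; apply: ideal_mul_is_ideal. Qed.

(** The submodule N + zJ: for N inside J, dividing J by it gives the cokernel of multiplication by z
    on J/N. *)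
Definition adjoin_mul N z J : R -> Prop :=
  fun u => exists a b, [/\ N a, J b & u = a + z * b].

Lemma adjoin_mul_is_ideal N z J :
  is_ideal N -> is_ideal J -> is_ideal (adjoin_mul N z J).
Proof.
move=> Ni Ji; split.
- by exists 0, 0; rewrite mulr0 addr0; split=> //; apply: is_ideal0.
- move=> _ _ [a [b [Na Jb ->]]] [a' [b' [Na' Jb' ->]]].
  exists (a + a'), (b + b'); rewrite mulrDr addrACA.
  by split=> //; apply: is_idealD.
- move=> h _ [a [b [Na Jb ->]]].
  exists (h * a), (h * b); rewrite mulrDr mulrCA.
  by split=> //; apply: is_idealMl.
Qed.

Lemma seq_ideal_rcons s z f :
  seq_ideal (rcons s z) f <-> adjoin_mul (seq_ideal s) z (fun=> True) f.
Proof.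
split.
  move: f; apply: ideal_gen_min.
    by apply: adjoin_mul_is_ideal; first exact: ideal_gen_is_ideal.
  move=> f; rewrite mem_rcons inE => /orP[/eqP ->|sf].
    exists 0, 1; rewrite mulr1 add0r; split=> //.
    exact: is_ideal0.
  by exists f, 0; rewrite mulr0 addr0; split=> //; apply: ideal_gen_self.
move=> [a [b [sa _ ->]]]; apply: is_idealD => //; last first.
  by apply: is_idealMr => //; apply: ideal_gen_self; rewrite mem_rcons mem_head.
move: a sa; apply: ideal_gen_min => // x sx; apply: ideal_gen_self.
by rewrite mem_rcons inE sx orbT.
Qed.

Lemma ideal_mul_rcons s z J u : is_ideal J ->
  ideal_mul (seq_ideal (rcons s z)) J u <->
  adjoin_mul (ideal_mul (seq_ideal s) J) z J u.
Proof.
move=> Ji; split.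
  move: u; apply: ideal_mul_min.
    by apply: adjoin_mul_is_ideal => //; apply: ideal_mul_is_ideal.
  move=> f g /seq_ideal_rcons[a [b [sa _ ->]]] Jg.
  exists (a * g), (b * g); rewrite mulrDl mulrA.
  split=> //; last exact: is_idealMl.
  exact: ideal_mulM.
move=> [a [b [Na Jb ->]]]; apply: is_idealD; first exact: ideal_mul_is_ideal.
  move: a Na; apply: ideal_mul_min; first exact: ideal_mul_is_ideal.
  move=> f g sf Jg; apply: ideal_mulM => //.
  apply/seq_ideal_rcons; exists f, 0; rewrite mulr0 addr0; split=> //.
apply: ideal_mulM => //; apply/seq_ideal_rcons; exists 0, 1.
by rewrite add0r mulr1; split=> //; apply: is_ideal0.
Qed.

End IdealTheory.
#[local] Hint Resolve ideal_gen_is_ideal seq_ideal_is_ideal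
  ideal_mul_is_ideal : core.

(** * The Koszul complex *)

Section Koszul.

Variables (R : comNzRingType) (x : nat -> R).
Implicit Types (J N : R -> Prop).

(* The Koszul complex of x_0, ..., x_(j-1), as the iterated mapping cone of the
   multiplications by the x_l. All indices are shifted by one: the term of
   degree i has rank [krk j i.+1], and [krk j 0 = 0] is its term of degree -1. *)
Fixpoint krk (j i : nat) {struct j} : nat :=
  match j, i with
  | _, 0 => 0
  | 0, i'.+1 => if i' is 0 then 1 else 0
  | j'.+1, i'.+1 => krk j' i'.+1 + krk j' i'
  end.

Lemma krk0 j : krk j 0 = 0%N. Proof. by case: j. Qed.

Lemma krkS j i : krk j i.+1 = 'C(j, i).
Proof.
elim: j i => [|j IHj] [|i] //=; first by rewrite IHj krk0 !bin0.
by rewrite !IHj binS.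
Qed.

Fixpoint kdf (j : nat) : forall i, 'M[R]_(krk j i.+1, krk j i) :=
  match j with
  | 0 => fun=> 0
  | j'.+1 => fun i =>
    match i return 'M[R]_(krk j'.+1 i.+1, krk j'.+1 i) with
    | 0 => 0
    | i'.+1 => block_mx (kdf j' i'.+1) 0 (x j')%:M (- kdf j' i')
    end
  end.

(** Exterior multiplication by the l-th basis vector. In the cone that adjoins x_l it embeds the old
    copy into the new one; later cones apply it to both copies, with a sign on the shifted one. *)
Fixpoint khtp (l j : nat) : forall i, 'M[R]_(krk j i, krk j i.+1) :=
  match j with
  | 0 => fun=> 0
  | j'.+1 => fun i =>
    match i return 'M[R]_(krk j'.+1 i, krk j'.+1 i.+1) with
    | 0 => 0
    | i'.+1 => if l == j' then block_mx 0 1%:M 0 0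
               else block_mx (khtp l j' i'.+1) 0 0 (- khtp l j' i')
    end
  end.

Lemma kdf_kdf j i : kdf j i.+1 *m kdf j i = 0.
Proof.
elim: j i => [|j IHj] [|i] /=; rewrite ?mulmx0 //.
rewrite mulmx_block !IHj !mulmx0 !mul0mx !mulmxN !mulNmx opprK IHj.
by rewrite mul_scalar_mx mul_mx_scalar !addr0 subrr block_mx0.
Qed.

(** [krk j 0] computes to 0 only once [j] is destructed, so blocks touching the term of degree -1
    are identified by this lemma and the next. *)
Lemma krk0_mx m j (A B : 'M[R]_(krk j 0, m)) : A = B.
Proof. by case: j A B => [|j] A B; rewrite [A]flatmx0 [B]flatmx0. Qed.

Lemma mx_krk0 m j (A B : 'M[R]_(m, krk j 0)) : A = B.
Proof. by case: j A B => [|j] A B; rewrite [A]thinmx0 [B]thinmx0. Qed.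

Lemma khtpP l j i : (l < j)%N ->
  kdf j i *m khtp l j i + khtp l j i.+1 *m kdf j i.+1 = (x l)%:M.
Proof.
elim: j i => [//|j IHj] i; rewrite ltnS leq_eqVlt => /orP[|lt_lj].
  move=> /eqP ->; case: i => [|i] /=; rewrite eqxx.
    rewrite mul0mx add0r mulmx_block !mul0mx !mul1mx !add0r.
    rewrite scalar_mx_block; congr block_mx; by [exact: mx_krk0 | exact: krk0_mx].
  rewrite !mulmx_block !mulmx0 !mul0mx !mulmx1 !mul1mx !addr0 !add0r.
  by rewrite add_block_mx scalar_mx_block add0r addrN addr0 addr0.
have neq_lj : (l == j) = false by apply: ltn_eqF.
case: i => [|i] /=; rewrite neq_lj.
  have := IHj 0%N lt_lj; rewrite [kdf j 0](@mx_krk0 _ _ _ 0) mul0mx add0r => IH0.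
  rewrite mul0mx add0r mulmx_block !mul0mx !mulmx0 !addr0 IH0 scalar_mx_block.
  congr block_mx; by [exact: mx_krk0 | exact: krk0_mx].
rewrite !mulmx_block !mulmx0 !mul0mx !addr0 !add0r !mulNmx !mulmxN !opprK.
rewrite add_block_mx scalar_mx_block !IHj // mul_scalar_mx mul_mx_scalar subrr.
by rewrite addr0.
Qed.

Lemma kdf_entries (P : R -> Prop) j : P 0 -> (forall a, P a -> P (- a)) ->
  (forall l, (l < j)%N -> P (x l)) -> forall i a b, P (kdf j i a b).
Proof.
move=> P0 PN; elim: j => [|j IHj] Px i a b; first by rewrite mxE.
have {}IHj := IHj (fun l lj => Px l (ltnW lj)).
case: i a b => [|i] a b; first by rewrite mxE.
rewrite /= mxE; case: split => c; rewrite mxE; case: split => e.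
- exact: IHj.
- by rewrite mxE.
- by rewrite mxE; case: (c == e); [apply: Px | ].
by rewrite mxE; apply: PN.
Qed.

End Koszul.

(** * Depth sensitivity of the Koszul complex *)

Section MatrixEntries.

Variable R : comNzRingType.
Implicit Types (J N : R -> Prop).

Definition mx_in J m n (A : 'M[R]_(m, n)) : Prop := forall a b, J (A a b).

Lemma mx_in0 J m n : is_ideal J -> mx_in J (0 : 'M_(m, n)).
Proof. by move=> Ji a b; rewrite mxE; apply: is_ideal0. Qed.

Lemma mx_inD J m n (A B : 'M_(m, n)) :
  is_ideal J -> mx_in J A -> mx_in J B -> mx_in J (A + B).
Proof. by move=> Ji JA JB a b; rewrite mxE; apply: is_idealD. Qed.

Lemma mx_inB J m n (A B : 'M_(m, n)) :
  is_ideal J -> mx_in J A -> mx_in J B -> mx_in J (A - B).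
Proof. by move=> Ji JA JB a b; rewrite !mxE; apply: is_idealB. Qed.

Lemma mx_inZ J m n c (A : 'M_(m, n)) :
  is_ideal J -> mx_in J A -> mx_in J (c *: A).
Proof. by move=> Ji JA a b; rewrite mxE; apply: is_idealMl. Qed.

Lemma mx_inM J m n p (A : 'M_(m, n)) (B : 'M_(n, p)) :
  is_ideal J -> mx_in J A -> mx_in J (A *m B).
Proof.
move=> Ji JA a b; rewrite mxE.
by apply: is_ideal_sum => // i _; apply: is_idealMr.
Qed.

Lemma mx_in_mull J m n p (A : 'M_(m, n)) (B : 'M_(n, p)) :
  is_ideal J -> mx_in J B -> mx_in J (A *m B).
Proof.
move=> Ji JB a b; rewrite mxE.
by apply: is_ideal_sum => // i _; apply: is_idealMl.
Qed.

Lemma mx_inS J N m n (A : 'M_(m, n)) :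
  (forall u, J u -> N u) -> mx_in J A -> mx_in N A.
Proof. by move=> JN JA a b; apply: JN. Qed.

Lemma mx_in_adjoin_mul N z J m n (A : 'M_(m, n)) :
  mx_in (adjoin_mul N z J) A ->
  exists B C, [/\ mx_in N B, mx_in J C & A = B + z *: C].
Proof.
move=> NA.
have {}NA (i : 'I_m * 'I_n) : exists c : R * R,
    [/\ N c.1, J c.2 & A i.1 i.2 = c.1 + z * c.2].
  by have [a [b abP]] := NA i.1 i.2; exists (a, b).
have [c cP] := fin_all_exists NA.
exists (\matrix_(i, j) (c (i, j)).1), (\matrix_(i, j) (c (i, j)).2); split.
- by move=> i j; rewrite mxE; have [] := cP (i, j).
- by move=> i j; rewrite mxE; have [] := cP (i, j).
by apply/matrixP => i j; rewrite !mxE; have [] := cP (i, j).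
Qed.

End MatrixEntries.

Section KoszulHomology.

Variables (R : comNzRingType) (x : nat -> R) (n : nat).
Implicit Types (J N : R -> Prop) (z : R).
Local Notation D := (kdf x n).

(* The Koszul homology H_i(x; J/N) vanishes; chains are represented by vectors
   with entries in J, taken modulo N. *)
Definition koszul_acyclic_at J N i : Prop :=
  forall v : 'rV[R]_(krk n i.+1), mx_in J v -> mx_in N (v *m D i) ->
  exists2 w : 'rV_(krk n i.+2), mx_in J w & mx_in N (v - w *m D i.+1).

(** The condition i > n - r, stated without truncated subtraction. *)
Definition koszul_acyclic_above J N r : Prop :=
  forall i, (n < r + i)%N -> koszul_acyclic_at J N i.

Definition null_homotopic z : Prop :=
  exists h : forall i, 'M[R]_(krk n i, krk n i.+1),
    forall i, D i *m h i + h i.+1 *m D i.+1 = z%:M.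

(** Homotopies add and scale. Hence every element of the ideal of the variables, of whatever degree,
    acts as zero on Koszul homology, and regular elements may be nonlinear. *)
Lemma null_homotopic_is_ideal : is_ideal null_homotopic.
Proof.
split.
- exists (fun=> 0) => i.
  by rewrite mulmx0 mul0mx addr0; apply/matrixP => a b; rewrite !mxE mul0rn.
- move=> f g [h hP] [h' hP']; exists (fun i => h i + h' i) => i.
  by rewrite mulmxDr mulmxDl addrACA hP hP' raddfD.
- move=> a f [h hP]; exists (fun i => a *: h i) => i.
  by rewrite -scalemxAr -scalemxAl -scalerDr hP scale_scalar_mx.
Qed.

Lemma null_homotopic_var l : (l < n)%N -> null_homotopic (x l).
Proof. by move=> lt_ln; exists (khtp R l n) => i; apply: khtpP. Qed.

Section ShortExactSequence.

Variables (J N : R -> Prop) (z : R).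
Hypotheses (Ji : is_ideal J) (Ni : is_ideal N).
Hypothesis z_reg : forall u, J u -> N (z * u) -> N u.

(** The connecting map onto H_i(J/N) is surjective because z acts as zero: for a cycle c, the chain
    [c *m h i.+1] has boundary zc modulo N, so it is a cycle modulo N + zJ. If it bounds there,
    cancelling z shows that c bounds. *)
Lemma koszul_acyclic_at_subr i : null_homotopic z ->
  koszul_acyclic_at J (adjoin_mul N z J) i.+1 -> koszul_acyclic_at J N i.
Proof.
move=> [h hP] exact_i c Jc Nc.
have N'i := adjoin_mul_is_ideal z Ni Ji.
pose n0 := c *m D i *m h i.
have Nn0 : mx_in N n0 by apply: mx_inM.
have zc : z *: c = n0 + c *m h i.+1 *m D i.+1.
  by rewrite -[n0]mulmxA -mulmxA -mulmxDr hP mul_mx_scalar.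
have cyc : mx_in (adjoin_mul N z J) (c *m h i.+1 *m D i.+1).
  move=> a b; exists (- n0 a b), (c a b); split=> //; first exact: is_idealN.
  by move/matrixP/(_ a b): zc; rewrite !mxE => ->; rewrite addKr.
have [e Je] := exact_i (c *m h i.+1) (mx_inM _ Ji Jc) cyc.
move=> /mx_in_adjoin_mul[n1 [w [Nn1 Jw eq_w]]].
exists w => // a b; apply: z_reg.
  by apply: (mx_inB Ji Jc (mx_inM _ Ji Jw)).
suff -> : z * (c - w *m D i.+1) a b = (n0 + n1 *m D i.+1) a b.
  exact: (mx_inD Ni Nn0 (mx_inM _ Ni Nn1)).
(* Applying the differential to [eq_w] kills the term in [e] and leaves zc equal to z times the
   boundary of w, up to elements of N. *)
have /(congr1 (mulmx^~ (D i.+1))) := eq_w.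
rewrite mulmxBl -(mulmxA e) kdf_kdf mulmx0 subr0 mulmxDl -scalemxAl => eq_d.
transitivity ((z *: (c - w *m D i.+1)) a b); first by rewrite !mxE.
by rewrite scalerBr zc eq_d addrA addrK.
Qed.

Lemma koszul_acyclic_at_quo0 : koszul_acyclic_at J N 0 ->
  koszul_acyclic_at J (adjoin_mul N z J) 0.
Proof.
move=> exact0 v Jv _; have [|w Jw Nw] := exact0 v Jv.
  by rewrite [_ *m _](@mx_krk0 _ _ _ _ 0); apply: mx_in0.
exists w => //; apply: mx_inS Nw => u Nu.
by exists u, 0; rewrite mulr0 addr0; split=> //; apply: is_ideal0.
Qed.

(** A cycle c modulo N + zJ has boundary n1 + zc', and c' is a cycle modulo N since z cancels. If c'
    is the boundary of b, then c - zb is a cycle modulo N and therefore bounds. *)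
Lemma koszul_acyclic_at_quo i : koszul_acyclic_at J N i ->
  koszul_acyclic_at J N i.+1 -> koszul_acyclic_at J (adjoin_mul N z J) i.+1.
Proof.
move=> exact_i exact_Si c Jc /mx_in_adjoin_mul[n1 [c' [Nn1 Jc' eq_c]]].
have cyc' : mx_in N (c' *m D i).
  move=> a b; apply: z_reg; first exact: (mx_inM _ Ji Jc').
  have /(congr1 (mulmx^~ (D i))) := eq_c.
  rewrite -mulmxA kdf_kdf mulmx0 mulmxDl -scalemxAl => /esym/eqP.
  rewrite addrC addr_eq0 => /eqP/matrixP/(_ a b).
  rewrite [LHS]mxE => ->; rewrite mxE; apply: is_idealN => //.
  exact: (mx_inM _ Ni Nn1).
have [b Jb Nb] := exact_i c' Jc' cyc'.
have cyc : mx_in N ((c - z *: b) *m D i.+1).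
  have -> : (c - z *: b) *m D i.+1 = n1 + z *: (c' - b *m D i.+1).
    by rewrite mulmxBl eq_c -scalemxAl scalerBr addrA.
  by apply: mx_inD => //; apply: mx_inZ.
have Jzb : mx_in J (c - z *: b) by apply: mx_inB => //; apply: mx_inZ.
have [e Je Ne] := exact_Si _ Jzb cyc.
exists e => // k l; exists ((c - z *: b - e *m D i.+2) k l), (b k l).
by split=> //; rewrite !mxE addrAC subrK.
Qed.

(** As z is zero on homology, the long exact sequence breaks up: H_(i+1) of the quotient by z is an
    extension of H_i(J/N) by H_(i+1)(J/N). Dividing by z thus raises the top nonvanishing degree by
    one. *)
Lemma koszul_acyclic_above_quo r : null_homotopic z ->
  koszul_acyclic_above J N r.+1 <->
  koszul_acyclic_above J (adjoin_mul N z J) r.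
Proof.
move=> z0; split=> acyc i lt_n; last first.
  by apply: koszul_acyclic_at_subr => //; apply: acyc; rewrite addnS -addSn.
case: i lt_n => [|i] lt_n.
  by apply: koszul_acyclic_at_quo0; apply: acyc; rewrite addSn ltnW.
apply: koszul_acyclic_at_quo; apply: acyc; first by rewrite addSn -addnS.
by rewrite addSn ltnW.
Qed.

End ShortExactSequence.

Lemma koszul_acyclic_above0 J N : is_ideal J -> is_ideal N ->
  koszul_acyclic_above J N 0.
Proof.
move=> Ji Ni i lt_ni v _ _; exists 0; first exact: mx_in0.
by move=> a b; have := ltn_ord b; rewrite {2}krkS bin_small.
Qed.

(** The term of degree n has rank one and nothing maps into it, so H_n is the socle of J/N: the
    elements killed by all x_l. *)
Lemma koszul_top_acyclic J N u : is_ideal J -> is_ideal N ->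
  koszul_acyclic_at J N n -> J u ->
  (forall l, (l < n)%N -> N (x l * u)) -> N u.
Proof.
move=> Ji Ni acyc Ju Nu; have rk1 : (0 < krk n n.+1)%N by rewrite krkS binn.
have [||w _] := acyc (const_mx u).
- by move=> a b; rewrite mxE.
- move=> a b; rewrite mxE; apply: is_ideal_sum => // k _; rewrite mxE mulrC.
  apply: (@kdf_entries _ x (fun f => N (f * u))) => //.
    by rewrite mul0r; apply: is_ideal0.
  by move=> f Nf; rewrite mulNr; apply: is_idealN.
move=> /(_ 0 (Ordinal rk1)); rewrite !mxE big1 ?subr0 // => k.
by have := ltn_ord k; rewrite {2}krkS bin_small.
Qed.

Lemma koszul_acyclic_above_eq J N N' r : (forall u, N u <-> N' u) ->
  koszul_acyclic_above J N r -> koszul_acyclic_above J N' r.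
Proof.
move=> NN' acyc i lt_n v Jv Nv.
have [|w Jw Nw] := acyc i lt_n v Jv; first by move=> a b; apply/NN'.
by exists w => // a b; apply/NN'.
Qed.

(** Induction on [t], the part still to be divided out: its head moves to the end of [s], at the
    cost of one degree of acyclicity. *)
Lemma koszul_acyclic_regular J s t : is_ideal J ->
  (forall z, z \in t -> null_homotopic z) ->
  (forall i u, (size s <= i < size (s ++ t))%N -> J u ->
     ideal_mul (seq_ideal (take i (s ++ t))) J ((s ++ t)`_i * u) ->
     ideal_mul (seq_ideal (take i (s ++ t))) J u) ->
  koszul_acyclic_above J (ideal_mul (seq_ideal s) J) (size t).
Proof.
move=> Ji; elim: t s => [|z t IHt] s htp_t reg_t.
  exact: koszul_acyclic_above0.
have take_s : take (size s) (s ++ z :: t) = s.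
  by rewrite take_cat ltnn subnn cats0.
apply/(@koszul_acyclic_above_quo J _ z Ji) => //.
- move=> u Ju; have := reg_t (size s) u.
  rewrite take_s nth_cat ltnn subnn leqnn size_cat /= -[ltnLHS]addn0 ltn_add2l.
  exact.
- by apply: htp_t; apply: mem_head.
apply: koszul_acyclic_above_eq (IHt (rcons s z) _ _).
- by move=> u; apply: ideal_mul_rcons.
- by move=> f tf; apply: htp_t; rewrite inE tf orbT.
by rewrite cat_rcons size_rcons => i u /andP[/ltnW le_i lt_i]; apply/reg_t/andP.
Qed.

End KoszulHomology.

(** * Zero divisors modulo an ideal of a Noetherian ring *)

(** An inaccessible element has an inaccessible predecessor; dependent choice strings these into a
    chain. *)
Lemma descending_chain (T : Type) (r : T -> T -> Prop) :
  ~ well_founded r -> exists a : nat -> T, forall k, r (a k.+1) (a k).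
Proof.
move=> /not_all_ex_not[x0 nacc0].
have step (y : {x | ~ Acc r x}) :
    exists z : {x | ~ Acc r x}, r (proj1_sig z) (proj1_sig y).
  apply: NNPP => nex; apply: (proj2_sig y); constructor => z rzx.
  by apply: NNPP => naccz; apply: nex; exists (exist _ z naccz).
pose next y := proj1_sig (constructive_indefinite_description _ (step y)).
exists (fun k => proj1_sig (iter k next (exist _ x0 nacc0))) => k /=.
exact: (proj2_sig (constructive_indefinite_description _ (step _))).
Qed.

Section Noetherian.

Variable R : comNzRingType.
Implicit Types (J N A : R -> Prop) (s t : seq R) (f g u z : R).

(** Well-foundedness of this relation is the ascending chain condition, in a form that serves
    directly as an induction principle on lists of generators. *)
Definition proper_ext t s : Prop :=
  exists2 f, ~ seq_ideal s f & t = rcons s f.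

Definition noetherian : Prop := well_founded proper_ext.

Hypothesis noethR : noetherian.

Lemma noetherian_fg A : exists2 s : seq R, (forall f, f \in s -> A f) &
  forall f, A f -> seq_ideal s f.
Proof.
suff : forall s, (forall f, f \in s -> A f) -> exists2 t,
    (forall f, f \in t -> A f) & forall f, A f -> seq_ideal t f.
  by move/(_ [::]); apply.
elim/(well_founded_induction noethR) => s IHs sA.
have [gen|/not_all_ex_not[f /(imply_to_and (A f))[Af nsf]]] :=
  classic (forall f, A f -> seq_ideal s f); first by exists s.
apply: (IHs (rcons s f)); first by exists f.
by move=> g; rewrite mem_rcons inE => /orP[/eqP ->|/sA].
Qed.

(** Noetherian induction on a list [s] inside [F u0]. If [F u0] is not maximal, a larger [F v]
    contains some f outside [F u0], and [rcons s f] is a proper extension inside [F v]. *)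
Lemma noetherian_maximal (T : Type) (F : T -> R -> Prop) (P : T -> Prop)
    (u0 : T) :
  (forall u : T, is_ideal (F u)) -> P u0 -> exists u : T, [/\ P u,
    forall f, F u0 f -> F u f
    & forall v, P v -> (forall f, F u f -> F v f) -> forall f, F v f -> F u f].
Proof.
move=> Fi; suff : forall s (u0 : T), P u0 -> (forall f, f \in s -> F u0 f) ->
    exists u : T, [/\ P u, forall f, F u0 f -> F u f
    & forall v, P v -> (forall f, F u f -> F v f) -> forall f, F v f -> F u f].
  by move/(_ [::] u0) => main Pu0; apply: main.
elim/(well_founded_induction noethR) => s IHs {}u0 Pu0 sF.
have [max_u0|] := classic (forall v, P v -> (forall f, F u0 f -> F v f) ->
  forall f, F v f -> F u0 f); first by exists u0.
move=> /not_all_ex_not[v /(imply_to_and (P v))[Pv]].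
move=> /(imply_to_and (forall f, _))[leF /not_all_ex_not[f]].
move=> /(imply_to_and (F v f))[Fvf nFf].
have [||u [Pu le_vu max_u]] := IHs (rcons s f) _ v Pv.
- exists f => // sf; apply: nFf; move: f sf {Fvf}.
  exact: (ideal_gen_min (Fi u0)).
- by move=> g; rewrite mem_rcons inE => /orP[/eqP ->|/sF/leF].
by exists u; split=> // g /leF/le_vu.
Qed.

Section Associated.

Variables J N : R -> Prop.
Hypotheses (Ji : is_ideal J) (Ni : is_ideal N).

Definition annq u : R -> Prop := fun a => N (a * u).

Definition max_annq u : Prop := [/\ J u, ~ N u &
  forall v, J v -> ~ N v -> (forall f, annq u f -> annq v f) ->
    forall f, annq v f -> annq u f].

Lemma annq_is_ideal u : is_ideal (annq u).
Proof.
split=> [|f g|h f] /=; rewrite /annq.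
- by rewrite mul0r; apply: is_ideal0.
- by rewrite mulrDl; apply: is_idealD.
by rewrite -mulrA; apply: is_idealMl.
Qed.
Hint Resolve annq_is_ideal : core.

(** If bu is nonzero modulo N, its annihilator contains that of u, hence equals it by maximality;
    and it contains a. *)
Lemma max_annq_prime u a b : max_annq u -> annq u (a * b) ->
  annq u a \/ annq u b.
Proof.
move=> [Ju nNu max_u] ab; have [?|nb] := classic (annq u b); first by right.
left; apply: (max_u (b * u)) => //; first exact: is_idealMl.
  by move=> f; rewrite /annq mulrCA; apply: is_idealMl.
by rewrite /annq mulrA.
Qed.

Lemma max_annq_exists u : J u -> ~ N u ->
  exists2 v, max_annq v & forall f, annq u f -> annq v f.
Proof.
move=> Ju nNu.
have [v [[Jv nNv] le_uv max_v]] :=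
  @noetherian_maximal _ annq (fun v => J v /\ ~ N v) u annq_is_ideal
    (conj Ju nNu).
by exists v => //; split=> // w Jw nNw; apply: max_v.
Qed.

Lemma max_annq_separate u s : max_annq u ->
  (forall v, v \in s -> exists2 a, annq v a & ~ annq u a) ->
  exists2 a, (forall v, v \in s -> annq v a) & ~ annq u a.
Proof.
move=> max_u; elim: s => [|v s IHs] sep.
  by exists 1 => //; rewrite /annq mul1r; case: max_u.
have [|a a_s a_u] := IHs; first by move=> w ws; apply: sep; rewrite inE ws orbT.
have [b b_v b_u] := sep v (mem_head _ _).
exists (a * b); last by move/(max_annq_prime max_u) => [].
by move=> w /[!inE] /orP[/eqP ->|/a_s]; [apply: is_idealMl|apply: is_idealMr].
Qed.

(* If v lies in the ideal generated by s, then annq v contains the intersection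
   of the annq u for u in s, hence one of them when annq v is prime. *)
Lemma max_annq_finite : exists2 s : seq R, (forall u, u \in s -> max_annq u) &
  forall v, max_annq v -> exists2 u, u \in s & forall f, annq u f -> annq v f.
Proof.
have [s max_s gen_s] := noetherian_fg max_annq.
exists s => // v max_v; apply: NNPP => nex.
have [|a a_s []] := @max_annq_separate v s max_v.
  move=> u us; apply: NNPP => nsep; apply: nex; exists u => // f uf.
  by apply: NNPP => nvf; apply: nsep; exists f.
suff : forall w, seq_ideal s w -> annq w a by move/(_ v (gen_s v max_v)).
apply: ideal_gen_min; last exact: a_s.
split=> [|f g|h f]; rewrite /annq.
- by rewrite mulr0; apply: is_ideal0.
- by rewrite mulrDr; apply: is_idealD.
by rewrite mulrCA; apply: is_idealMl.
Qed.

(** Prime avoidance. If the z found for [s] falls into [annq u], it is corrected by a product ya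
    with y in m, where a lies in all the earlier annihilators and neither factor lies in
    [annq u]. *)
Lemma max_annq_avoidance (m : R -> Prop) s : is_ideal m ->
  (forall u, u \in s -> max_annq u) ->
  (forall u, u \in s -> exists2 y, m y & ~ annq u y) ->
  exists2 z, m z & forall u, u \in s -> ~ annq u z.
Proof.
move=> mi; elim: s => [|u s IHs] max_s avoid.
  by exists 0 => //; apply: is_ideal0.
have [||z mz z_s] := IHs.
    by move=> v vs; apply: max_s; rewrite inE vs orbT.
  by move=> v vs; apply: avoid; rewrite inE vs orbT.
have [zu|nzu] := classic (annq u z); last first.
  by exists z => // v /[!inE] /orP[/eqP ->|/z_s].
have max_u := max_s u (mem_head _ _).
have [|a a_s a_u] := @max_annq_separate u s max_u.
  (* If [annq v] were contained in [annq u], maximality would make them equal, and z would lie in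
     [annq v]. *)
  move=> v vs; apply: NNPP => nsep; apply: (z_s v vs).
  have [Jv nNv max_v] : max_annq v by apply: max_s; rewrite inE vs orbT.
  have [Ju nNu _] := max_u; apply: (max_v u) => // f vf.
  by apply: NNPP => nuf; apply: nsep; exists f.
have [y my y_u] := avoid u (mem_head _ _).
have yau : ~ annq u (y * a) by move/(max_annq_prime max_u) => [].
exists (z + y * a); first by apply: is_idealD => //; apply: is_idealMr.
move=> v /[!inE] /orP[/eqP -> zya|vs zya]; [apply: yau | apply: (z_s v vs)].
  by rewrite -[y * a](addKr z) addrC; apply: is_idealB.
rewrite -[z](addrK (y * a)); apply: is_idealB => //.
by apply: is_idealMl => //; apply: a_s.
Qed.

(** A maximal annihilator containing m would come from a nonzero socle element, so m avoids the
    finitely many in [s]. Any zero divisor lies in some maximal annihilator, which coincides with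
    one of those. *)
Lemma exists_nonzerodivisor (m : R -> Prop) : is_ideal m ->
  (forall u, J u -> (forall z, m z -> N (z * u)) -> N u) ->
  exists2 z, m z & forall u, J u -> N (z * u) -> N u.
Proof.
move=> mi socle0; have [s max_s cover_s] := max_annq_finite.
have [|z mz z_s] := @max_annq_avoidance m s mi max_s.
  move=> u /max_s[Ju nNu _]; apply: NNPP => nex; apply: nNu.
  apply: socle0 => // z mz; apply: NNPP => nzu; apply: nex.
  by exists z.
exists z => // u Ju zu; apply: NNPP => nNu.
have [v max_v le_uv] := max_annq_exists Ju nNu.
have [w ws le_wv] := cover_s v max_v.
have [Jv nNv _] := max_v; have [_ _ max_w] := max_s w ws.
by apply: (z_s w ws); apply: (max_w v Jv nNv le_wv); apply: le_uv.
Qed.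

End Associated.

End Noetherian.

(** * Hilbert basis theorem *)

Section Dickson.

Lemma nat_nondecreasing_subseq (a : nat -> nat) : exists phi : nat -> nat,
  {homo phi : i j / (i < j)%N} /\ {homo a \o phi : i j / (i <= j)%N}.
Proof.
have min_after p :
    exists q, (p <= q)%N /\ forall r, (p <= r)%N -> (a q <= a r)%N.
  (* Descent on the bound [b]: as long as some index past [p] has a smaller value, it replaces
     [q]. *)
  suff : forall b q, (p <= q)%N -> (a q < b)%N -> exists q, (p <= q)%N /\
      forall r, (p <= r)%N -> (a q <= a r)%N.
    by move/(_ (a p).+1 p (leqnn p) (ltnSn _)).
  elim=> // b IHb q le_pq lt_qb.
  have [min_q|] := classic (forall r, (p <= r)%N -> (a q <= a r)%N).
    by exists q.
  move=> /not_all_ex_not[r /(imply_to_and (p <= r)%N)[le_pr /negP]].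
  by rewrite -ltnNge => lt_rq; apply: (IHb r le_pr); apply: leq_trans lt_rq _.
pose g p := proj1_sig (constructive_indefinite_description _ (min_after p)).
have gP p : (p <= g p)%N /\ forall r, (p <= r)%N -> (a (g p) <= a r)%N.
  exact: (proj2_sig (constructive_indefinite_description _ (min_after p))).
pose phi := fix phi k := if k is k'.+1 then g (phi k').+1 else g 0.
have phiS k : (phi k < phi k.+1)%N by case: (gP (phi k).+1).
exists phi; split; first by apply: homo_ltn phiS; exact: ltn_trans.
apply: homo_leq => // [|k]; first exact: leq_trans.
case: k => [|k]; first exact: (proj2 (gP 0%N)).
exact: (proj2 (gP (phi k).+1)) (ltn_trans (phiS k) (phiS k.+1)).
Qed.

(** The sequence is thinned one coordinate at a time; a subsequence keeps the monotonicity already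
    achieved. *)
Lemma dickson n (m : nat -> 'X_{1..n}) :
  exists i j, (i < j)%N /\ (m i <= m j)%MM.
Proof.
suff : forall l : seq 'I_n, exists phi : nat -> nat,
    {homo phi : i j / (i < j)%N} /\
    forall c, c \in l -> {homo (fun k => m (phi k) c) : i j / (i <= j)%N}.
  move=> /(_ (enum 'I_n))[phi [phi_lt phi_le]].
  exists (phi 0%N), (phi 1%N); split; first exact: phi_lt.
  by apply/mnm_lepP => c; apply: phi_le; rewrite ?mem_enum.
elim=> [|c l [phi [phi_lt phi_le]]];
  first by exists id; split=> [i j|c] //; rewrite in_nil.
have [psi [psi_lt psi_le]] := nat_nondecreasing_subseq (fun k => m (phi k) c).
exists (phi \o psi); split=> [i j lt_ij|c']; first exact/phi_lt/psi_lt.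
rewrite inE => /orP[/eqP -> //|c'l] i j le_ij /=; apply: phi_le => //.
by rewrite leq_mono.
Qed.

End Dickson.

Section HilbertBasis.

Variables (K : fieldType) (n : nat).
Local Notation S := {mpoly K[n]}.
Implicit Types (A B J : S -> Prop) (f g : S).

Definition lead_in A (m : 'X_{1..n}) : Prop :=
  exists2 f, A f & f != 0 /\ mlead f = m.

(** Reduction by leading terms: an element of A with the same leading monomial, suitably scaled,
    cancels the leading term of f, and the difference is smaller. *)
Lemma lead_in_subset A B : is_ideal A -> is_ideal B -> (forall f, A f -> B f) ->
  (forall m, lead_in B m -> lead_in A m) -> forall f, B f -> A f.
Proof.
move=> Ai Bi AB lead_BA; apply: mleadrect => f IHf Bf.
have [->|nz_f] := eqVneq f 0; first exact: is_ideal0.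
have [|g Ag [nz_g lead_g]] := lead_BA (mlead f); first by exists f.
have Acg c : A (c *: g) by rewrite -mul_mpolyC; apply: is_idealMl.
pose c := mleadc f / mleadc g; pose q := f - c *: g.
suff Aq : A q by rewrite -(subrK (c *: g) f); apply: is_idealD.
have [->|nz_q] := eqVneq q 0; first exact: is_ideal0.
apply: IHf; last by apply: is_idealB => //; apply: AB.
rewrite lt_neqAle; apply/andP; split.
  apply: contraNneq nz_q => lead_q; rewrite -mleadc_eq0 lead_q.
  by rewrite mcoeffB mcoeffZ -lead_g divfK ?lead_g ?subrr // -lead_g mleadc_eq0.
apply: le_trans (mleadB_le _ _) _; rewrite leUx lexx /= -lead_g.
exact: mleadZ_le.
Qed.

(** Along an infinite strictly ascending chain each step creates a new leading monomial. By
    Dickson's lemma an earlier one divides a later one, which was then not new. *)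
Lemma mpoly_noetherian : noetherian S.
Proof.
apply: NNPP => /descending_chain[s sP].
pose A k := seq_ideal (s k).
have Ai k : is_ideal (A k) by apply: seq_ideal_is_ideal.
have AS k f : A k f -> A k.+1 f.
  move: f; apply: ideal_gen_min; first exact: Ai.
  move=> f sf; apply: ideal_gen_self.
  by have [g _ ->] := sP k; rewrite mem_rcons inE sf orbT.
have new_lead k : exists m, lead_in (A k.+1) m /\ ~ lead_in (A k) m.
  apply: NNPP => nex; have [f nAf eq_s] := sP k; apply: nAf.
  apply: (lead_in_subset (Ai k) (Ai k.+1) (@AS k)).
    move=> m lead_m; apply: NNPP => nlead_m; apply: nex.
    by exists m.
  by rewrite /A eq_s; apply: ideal_gen_self; rewrite mem_rcons mem_head.
pose m k := proj1_sig (constructive_indefinite_description _ (new_lead k)).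
have mP k : lead_in (A k.+1) (m k) /\ ~ lead_in (A k) (m k).
  exact: (proj2_sig (constructive_indefinite_description _ (new_lead k))).
have [i [j [lt_ij le_m]]] := dickson m.
have [[g Ag [nz_g lead_g]] _] := mP i; have [_ []] := mP j.
have {}Ag : A j g.
  elim: {le_m} j lt_ij => // j IHj.
  by rewrite ltnS leq_eqVlt => /orP[/eqP <- //|/IHj/AS].
exists ('X_[m j - m i] * g); first exact: is_idealMl.
have nz_X : 'X_[m j - m i] != 0 :> S by rewrite -msupp_eq0 msuppX.
by rewrite mulf_neq0 // mleadM // mleadXm lead_g submK.
Qed.

End HilbertBasis.

(** * Orders of polynomials *)

Section Orders.

Variables (K : fieldType) (n : nat).
Local Notation S := {mpoly K[n]}.
Implicit Types (I J N : S -> Prop) (f g h u : S).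

Definition order_ge t f : Prop := forall m, m \in msupp f -> (t <= mdeg m)%N.

Lemma order_geM s t f g :
  order_ge s f -> order_ge t g -> order_ge (s + t) (f * g).
Proof.
move=> sf tg m /msuppM_le /allpairsP[[m1 m2] [/= /sf le1 /tg le2 ->]].
by rewrite mdegD leq_add.
Qed.

Lemma order_ge_is_ideal t : is_ideal (order_ge t).
Proof.
split=> [m|f g tf tg m /msuppD_le|h f tf].
- by rewrite msupp0 in_nil.
- by rewrite mem_cat => /orP[/tf|/tg].
by have := @order_geM 0 t h f; apply.
Qed.
Hint Resolve order_ge_is_ideal : core.

Lemma dhomog_order_ge t f : f \is t.-homog -> order_ge t f.
Proof. by move=> /dhomogP hom_f m /hom_f ->. Qed.

Lemma dhomog_order_gt_eq0 t f : f \is t.-homog -> order_ge t.+1 f -> f = 0.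
Proof.
move=> /dhomogP hom_f gt_f; apply/eqP; rewrite -msupp_eq0.
case E: (msupp f) => [//|m s]; have mf : m \in msupp f by rewrite E mem_head.
by have := gt_f m mf; rewrite hom_f // ltnn.
Qed.

Lemma pihomogM t e f g : g \is e.-homog ->
  pihomog mdeg (t + e) (f * g) = pihomog mdeg t f * g.
Proof.
(* The bound also exceeds t, so that the component of degree t is a summand even when t is beyond
   the degree of f. *)
move=> hom_g; pose k := maxn (msize f) t.+1.
have t_lt : (t < k)%N by rewrite leq_maxr.
rewrite {1}(@pihomog_partitionE _ _ mdeg k f) ?leq_maxl //.
rewrite mulr_suml raddf_sum /= (bigD1 (Ordinal t_lt)) //= big1 => [|i ne_it].
  by rewrite addr0 pihomog_dE // dhomogM // pihomogP.
apply: (@pihomog_ne0 _ _ _ (i + e)%N); last by rewrite dhomogM // pihomogP.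
by rewrite eqn_add2r.
Qed.

Lemma pihomog_order_gt t f : order_ge t.+1 f -> pihomog mdeg t f = 0.
Proof.
move=> gt_f; rewrite pihomogE big_seq_cond big_pred0 // => m.
by apply/negP => /andP[/gt_f + /eqP eq_m]; rewrite eq_m ltnn.
Qed.

Lemma generated_in_degree_order_ge e J f :
  generated_in_degree e J -> J f -> order_ge e f.
Proof.
move=> genJ /genJ; move: f; apply: ideal_gen_min.
  exact: order_ge_is_ideal.
by move=> g [_]; apply: dhomog_order_ge.
Qed.

(** For g homogeneous of degree e, each component of cg is zero or a component of c times g. This
    supplies the gradedness of the powers of I. *)
Lemma generated_in_degree_graded e J :
  is_ideal J -> generated_in_degree e J -> graded_ideal J.
Proof.
move=> Ji genJ; split=> // f t /genJ[s sP ->].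
rewrite big_seq raddf_sum /=; apply: is_ideal_sum => // x /sP[Jx hom_x].
have [le_et|lt_te] := leqP e t.
  by rewrite -(subnK le_et) pihomogM //; apply: is_idealMl.
rewrite pihomog_order_gt; first exact: is_ideal0.
move=> m xm; apply: leq_trans lt_te _; move: m xm.
exact: (@order_geM 0 e _ _ (fun _ _ => leq0n _) (dhomog_order_ge hom_x)).
Qed.

Lemma generated_in_degree_nonzero e J f : generated_in_degree e J -> J f ->
  f != 0 -> exists g, [/\ J g, g \is e.-homog & g != 0].
Proof.
move=> genJ Jf nz_f; apply: NNPP => nex; move/eqP: nz_f; apply.
move/genJ: Jf; move: f.
apply: ideal_gen_min; first exact: zero_is_ideal.
move=> g [Jg hom_g]; apply/eqP/negPn/negP => nz_g.
by apply: nex; exists g.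
Qed.

Lemma ideal_mul_order_ge I J s t f : (forall g, I g -> order_ge s g) ->
  (forall g, J g -> order_ge t g) -> ideal_mul I J f -> order_ge (s + t) f.
Proof.
move=> sI tJ; move: f; apply: ideal_mul_min; first exact: order_ge_is_ideal.
by move=> f g /sI sf /tJ tg; apply: order_geM.
Qed.

End Orders.

(** * The Koszul resolution of the residue field *)

Section KoszulResolution.

Variables (K : fieldType) (n : nat).
Local Notation S := {mpoly K[n]}.
Implicit Types (J N : S -> Prop) (f g h u z : S).
Local Notation maxid := (@irrelevant_ideal K n).

Lemma maxid_is_ideal : is_ideal maxid.
Proof. exact: ideal_gen_is_ideal. Qed.
Hint Resolve maxid_is_ideal : core.

Definition mvars : seq S := [seq 'X_i | i <- enum 'I_n].

Lemma size_mvars : size mvars = n.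
Proof. by rewrite size_map size_enum_ord. Qed.

Lemma nth_mvars (i : 'I_n) : mvars`_i = 'X_i.
Proof. by rewrite (nth_map i) ?size_enum_ord // nth_ord_enum. Qed.

Local Notation D := (kdf (nth 0 mvars) n).

Lemma mvars_maxid l : (l < n)%N -> maxid mvars`_l.
Proof.
move=> lt_ln; rewrite (nth_mvars (Ordinal lt_ln)).
by apply: ideal_gen_self; exists (Ordinal lt_ln).
Qed.

Lemma null_homotopic_maxid z : maxid z -> null_homotopic (nth 0 mvars) n z.
Proof.
move: z; apply: ideal_gen_min; first exact: null_homotopic_is_ideal.
by move=> _ [i ->]; rewrite -nth_mvars; apply: null_homotopic_var.
Qed.

(** The ideal of the first i variables, described by monomials; regularity of the variables becomes
    a check on exponents. *)
Definition uses_first_vars (i : nat) f : Prop := forall m, m \in msupp f ->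
  exists2 c : 'I_n, (c < i)%N & m c != 0%N.

Lemma uses_first_vars_is_ideal i : is_ideal (uses_first_vars i).
Proof.
split=> [m|f g fP gP m /msuppD_le|h f fP m /msuppM_le].
- by rewrite msupp0 in_nil.
- by rewrite mem_cat => /orP[/fP|/gP].
move=> /allpairsP[[m1 m2] [/= _ /fP[c lt_ci nz_c] ->]].
by exists c; rewrite // mnmDE addn_eq0 negb_and nz_c orbT.
Qed.

Lemma ideal_uses_first_vars i J f : is_ideal J ->
  (forall c : 'I_n, (c < i)%N -> J 'X_c) -> uses_first_vars i f -> J f.
Proof.
move=> Ji JX fP; rewrite [f]mpolyE big_seq; apply: is_ideal_sum => // m /fP.
move=> [c lt_ci nz_c]; rewrite -mul_mpolyC; apply: is_idealMl => //.
rewrite -(@submK _ U_(c)%MM m) ?lep1mP // mpolyXD.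
by apply: is_idealMl => //; apply: JX.
Qed.

Lemma mul_seq_vars i f : (i <= n)%N ->
  ideal_mul (seq_ideal (take i mvars)) (fun=> True) f <-> uses_first_vars i f.
Proof.
move=> le_in; split.
  move: f; apply: ideal_mul_min; first exact: uses_first_vars_is_ideal.
  move=> f g + _; rewrite mulrC => fP.
  apply: (is_idealMl _ (uses_first_vars_is_ideal i)).
  move: f fP; apply: ideal_gen_min; first exact: uses_first_vars_is_ideal.
  move=> f /(nthP 0)[l]; rewrite size_takel ?size_mvars // => lt_li <- m.
  rewrite nth_take // (nth_mvars (Ordinal (leq_trans lt_li le_in))).
  rewrite msuppX inE => /eqP ->; exists (Ordinal (leq_trans lt_li le_in)) => //.
  by rewrite mnm1E eqxx.
apply: ideal_uses_first_vars => // c lt_ci; rewrite -['X_c]mulr1.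
apply: ideal_mulM => //; apply: ideal_gen_self.
rewrite -nth_mvars -(nth_take 0 lt_ci) mem_nth //.
by rewrite size_takel ?size_mvars.
Qed.

Lemma maxidP f : maxid f <-> f@_0%MM = 0.
Proof.
split; last first.
  move=> f0; apply: (@ideal_uses_first_vars n) => // [c _|m].
    by apply: ideal_gen_self; exists c.
  rewrite mcoeff_msupp => nz_fm; apply: NNPP => nex.
  move/eqP: nz_fm; apply; rewrite -f0; congr (_ @_ _); apply/mnmP => c.
  rewrite mnm0E; apply/eqP/negPn/negP => nz_c; apply: nex.
  by exists c.
move: f; apply: ideal_gen_min.
  split=> [|f g f0 g0|h f f0]; first by rewrite mcoeff0.
    by rewrite mcoeffD f0 g0 addr0.
  by rewrite rmorphM /= f0 mulr0.
by move=> _ [i ->]; rewrite mcoeffX mnm1_eq0.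
Qed.

Lemma kdf_homog i a b : D i a b \is 1.-homog.
Proof.
apply: (@kdf_entries _ _ (fun f => f \is 1.-homog)) => [|f|l lt_ln].
- exact: dhomog0.
- by rewrite rpredN.
by rewrite (nth_mvars (Ordinal lt_ln)) dhomogX; apply/eqP/mdeg1.
Qed.

Lemma kdf_maxid i a b : maxid (D i a b).
Proof.
apply: kdf_entries => [|f|l]; [exact: is_ideal0|exact: is_idealN|].
exact: mvars_maxid.
Qed.

(** Multiplication by X_c changes only the exponent at c, which is not among the indices below c. *)
Lemma uses_first_vars_regular (c : 'I_n) f :
  uses_first_vars c ('X_c * f) -> uses_first_vars c f.
Proof.
move=> Xf m mf; have [|c' lt_c nz_c'] := Xf (m + U_(c))%MM.
  by rewrite mcoeff_msupp mulrC addmC mcoeffMX -mcoeff_msupp.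
exists c' => //; move: nz_c'; rewrite mnmDE mnm1E.
by rewrite (_ : c == c' = false) ?addn0 //; apply: gtn_eqF.
Qed.

(** The n variables form a regular sequence on S, so homology vanishes in all positive degrees; this
    gives exactness of the Koszul resolution. *)
Lemma koszul_acyclic_ring :
  koszul_acyclic_above (nth 0 mvars) n (fun=> True) (fun f => f = 0) n.
Proof.
suff: koszul_acyclic_above (nth 0 mvars) n (fun=> True) (fun f => f = 0)
    (size mvars) by rewrite size_mvars.
apply: koszul_acyclic_above_eq (@koszul_acyclic_regular _ _ n _ [::] mvars _ _ _).
- move=> u; split=> [/ideal_mul_nil //|->].
  exact: (is_ideal0 (ideal_mul_is_ideal _ _)).
- by [].
- move=> z /(nthP 0)[l]; rewrite size_mvars => lt_ln <-.
  exact/null_homotopic_maxid/mvars_maxid.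
move=> i u /=; rewrite size_mvars => lt_in _.
move=> /(mul_seq_vars _ (ltnW lt_in)); rewrite (nth_mvars (Ordinal lt_in)) => Xu.
apply/(mul_seq_vars _ (ltnW lt_in)).
exact: (@uses_first_vars_regular (Ordinal lt_in)).
Qed.

Lemma krk1 : krk n 1 = 1%N. Proof. by rewrite krkS bin0. Qed.

Lemma augmentation_ones (v : 'rV[S]_(krk n 1)) :
  augmentation (const_mx 1 : 'cV[K]_(krk n 1)) v = 0 <-> mx_in maxid v.
Proof.
rewrite /augmentation; move: v; rewrite krk1 => v; rewrite big_ord1 mxE mulr1.
split=> [v0 a b|v0]; last exact/maxidP.
by rewrite !ord1; apply/maxidP.
Qed.

(** In degree 0 the outgoing differential is zero, so the homotopy for an element z of the maximal
    ideal exhibits z times a basis vector as a boundary. *)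
Lemma maxid_boundary (v : 'rV[S]_(krk n 1)) :
  mx_in maxid v <-> exists w, v = w *m D 1.
Proof.
split=> [v_m|[w ->]]; last by apply: mx_in_mull => // a b; apply: kdf_maxid.
rewrite [v]row_sum_delta; elim/big_ind: _ => [|_ _ [w ->] [w' ->]|l _].
- by exists 0; rewrite mul0mx.
- by exists (w + w'); rewrite mulmxDl.
have [h hP] := null_homotopic_maxid (v_m 0 l).
exists (delta_mx 0 l *m h 1%N); rewrite -mulmxA -mul_mx_scalar -(hP 0%N).
by rewrite [D 0](@mx_krk0 _ _ _ _ 0) mul0mx add0r.
Qed.

Lemma koszul_df_homog i (k : 'I_(krk n i.+2)) (l : 'I_(krk n i.+1)) :
  homog_int (i.+1%:Z - i%:Z) (D i.+1 k l).
Proof. by rewrite intS addrK; apply: kdf_homog. Qed.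

Lemma koszul_augmentation_surj (a : K) :
  exists v : 'rV[S]_(krk n 1), augmentation (const_mx 1) v = a.
Proof.
exists (const_mx a%:MP); rewrite /augmentation krk1 big_ord1 !mxE mulr1.
by rewrite mcoeffC eqxx mulr1.
Qed.

Lemma koszul_augmentation_exact (v : 'rV[S]_(krk n 1)) :
  augmentation (const_mx 1 : 'cV[K]_(krk n 1)) v = 0 <-> exists w, v = w *m D 1.
Proof. by rewrite augmentation_ones maxid_boundary. Qed.

Lemma koszul_df_exact i (v : 'rV[S]_(krk n i.+2)) :
  v *m D i.+1 = 0 <-> exists w, v = w *m D i.+2.
Proof.
split=> [v0|[w ->]]; last by rewrite -mulmxA kdf_kdf mulmx0.
have [|//||w _ vw] := koszul_acyclic_ring (i := i.+1) _ (v := v).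
- by rewrite addnS ltnS leq_addr.
- by move=> a b; rewrite v0 mxE.
exists w; apply/eqP; rewrite -subr_eq0; apply/eqP/matrixP => a b.
by rewrite vw mxE.
Qed.

(** The differentials are linear, so the basis of F_i sits in degree i and a chain of degree i + t
    has coefficients of degree t. *)
Definition koszul_resolution : graded_free_resolution K n :=
  @GradedFreeResolution K n (fun i => krk n i.+1) (fun i _ => i%:Z)
    (fun i => D i.+1) (const_mx 1) koszul_df_homog (fun _ _ => erefl)
    koszul_augmentation_surj koszul_augmentation_exact koszul_df_exact.

End KoszulResolution.

(** * Depth and Koszul homology *)

Section Depth.

Variables (K : fieldType) (n : nat).
Local Notation S := {mpoly K[n]}.
Implicit Types (J N : S -> Prop) (f g h u z : S).
Local Notation maxid := (@irrelevant_ideal K n).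
Local Notation X := (nth 0 (mvars K n)).
Local Notation D := (kdf X n).

(** Nonvanishing of J/(s)J is left out here; for [s] in the maximal ideal it follows from J
    differing from its product with that ideal. *)
Definition weakly_regular J (s : seq S) : Prop :=
  forall i u, (i < size s)%N -> J u ->
    ideal_mul (seq_ideal (take i s)) J (s`_i * u) ->
    ideal_mul (seq_ideal (take i s)) J u.

Lemma regular_seq_koszul_acyclic J s : is_ideal J ->
  (forall z, z \in s -> maxid z) -> weakly_regular J s ->
  koszul_acyclic_above X n J (fun u => u = 0) (size s).
Proof.
move=> Ji s_m reg_s.
apply: koszul_acyclic_above_eq (@koszul_acyclic_regular _ X n J [::] s Ji _ _).
- move=> u; split=> [/ideal_mul_nil //|->].
  exact: (is_ideal0 (ideal_mul_is_ideal _ _)).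
- by move=> z /s_m/null_homotopic_maxid.
by [].
Qed.

Lemma weakly_regular_rcons J s z : is_ideal J -> weakly_regular J s ->
  (forall u, J u -> ideal_mul (seq_ideal s) J (z * u) ->
     ideal_mul (seq_ideal s) J u) ->
  weakly_regular J (rcons s z).
Proof.
move=> Ji reg_s reg_z i u; rewrite size_rcons ltnS leq_eqVlt.
case/orP=> [/eqP ->|lt_i].
  by rewrite -cats1 take_size_cat // nth_cat ltnn subnn; apply: reg_z.
by rewrite nth_rcons lt_i -cats1 takel_cat 1?ltnW //; apply: reg_s.
Qed.

(** Vanishing of H_n means that J/(s)J has zero socle, so the maximal ideal contains a
    nonzerodivisor z on it. Appending z to [s] lowers r by one. *)
Lemma weakly_regular_extend J s r : is_ideal J ->
  (forall z, z \in s -> maxid z) -> weakly_regular J s ->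
  koszul_acyclic_above X n J (ideal_mul (seq_ideal s) J) r ->
  exists t, [/\ size t = r, forall z, z \in s ++ t -> maxid z
    & weakly_regular J (s ++ t)].
Proof.
move=> Ji; elim: r s => [|r IHr] s s_m reg_s acyc.
  by exists [::]; rewrite cats0.
have Ni := ideal_mul_is_ideal (seq_ideal s) J.
have mi := @maxid_is_ideal K n.
have [|z mz z_reg] := exists_nonzerodivisor (@mpoly_noetherian K n) Ji Ni mi.
  move=> u Ju socle_u; apply: (koszul_top_acyclic Ji Ni _ Ju).
    by apply: acyc; rewrite addSn ltnS leq_addl.
  by move=> l lt_ln; apply/socle_u/mvars_maxid.
have [|||t [size_t t_m reg_t]] := IHr (rcons s z).
- by move=> f; rewrite mem_rcons inE => /orP[/eqP ->|/s_m].
- exact: weakly_regular_rcons.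
- apply: (@koszul_acyclic_above_eq _ _ _ _
    (adjoin_mul (ideal_mul (seq_ideal s) J) z J)).
    by move=> u; rewrite ideal_mul_rcons.
  by apply/koszul_acyclic_above_quo => //; apply: null_homotopic_maxid.
by exists (z :: t); rewrite -cat_rcons /= size_t.
Qed.

Lemma regular_seq_in_weakly_regular J s u : J u -> ~ ideal_mul maxid J u ->
  (forall z, z \in s -> maxid z) -> weakly_regular J s ->
  regular_seq_in maxid J s.
Proof.
move=> Ju nmJu s_m reg_s; split=> //; split=> //; exists u => // sJu.
apply: nmJu.
move: u sJu {Ju}; apply: ideal_mul_min; first exact: ideal_mul_is_ideal.
move=> f g sf Jg; apply: ideal_mulM => //; move: f sf.
by apply: ideal_gen_min; first exact: maxid_is_ideal.
Qed.

Definition graded_part t m (v : 'rV[S]_m) : 'rV[S]_m :=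
  map_mx (pihomog mdeg t) v.

Lemma graded_partM t i (v : 'rV[S]_(krk n i.+1)) :
  graded_part t v *m D i = graded_part t.+1 (v *m D i).
Proof.
apply/rowP => b; rewrite !mxE raddf_sum /=; apply: eq_bigr => a _.
by rewrite mxE -(addn1 t) pihomogM // kdf_homog.
Qed.

Lemma graded_part_sum m (v : 'rV[S]_m) :
  exists k, v = \sum_(t < k) graded_part t v.
Proof.
exists (\max_a msize (v 0%R a)); apply/rowP => a.
rewrite summxE [LHS](@pihomog_partitionE _ _ mdeg (\max_a msize (v 0%R a))).
  by apply: eq_bigr => t _; rewrite mxE.
exact: (leq_bigmax a).
Qed.

Lemma koszul_acyclic_transfer J J' d e f i :
  graded_ideal J -> is_ideal J' -> (forall u, J' u -> order_ge (d + e) u) ->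
  f \is d.-homog -> f != 0 -> (forall u, J u -> J' (f * u)) ->
  (forall j : int, j != e -> tor_component_eq0 J i (i%:Z + j)) ->
  koszul_acyclic_at X n J' (fun u => u = 0) i ->
  koszul_acyclic_at X n J (fun u => u = 0) i.
Proof.
move=> [Ji Jhom] J'i ordJ' hom_f nz_f fJ lin acyc v Jv vD.
have zi := zero_is_ideal S.
suff part t : exists2 w : 'rV[S]_(krk n i.+2),
    mx_in J w & graded_part t v = w *m D i.+1.
  have [k ->] := graded_part_sum v.
  elim/big_ind: _ => [|u1 u2 [w1 Jw1 eq1] [w2 Jw2 eq2]|t _].
  - by exists 0; [apply: mx_in0|rewrite mul0mx subr0; apply: mx_in0].
  - exists (w1 + w2); first exact: mx_inD.
    rewrite mulmxDl opprD addrACA; exact: (mx_inD zi eq1 eq2).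
  by have [w Jw ->] := part t; exists w => // a b; rewrite subrr mxE.
have vD0 : v *m D i = 0 by apply/matrixP => a b; rewrite vD mxE.
have cyc : graded_part t v *m D i = 0.
  by rewrite graded_partM vD0 /graded_part map_mx0.
have Jt : mx_in J (graded_part t v) by move=> a b; rewrite mxE; apply: Jhom.
have [eq_te|ne_te] := eqVneq t e; last first.
  (* Off degree e the part is a cycle of degree i + t in the Koszul complex over J, and linearity
     makes it a boundary. *)
  have [|||w Jw ->] := lin t _ (koszul_resolution K n) (graded_part t v).
  - by [].
  - move=> l; split; first exact: Jt.
    by rewrite /= addrAC subrr add0r mxE; apply: pihomogP.
  - by case: (i) v cyc {vD vD0 Jv Jt}.
  by exists w => // a b; rewrite ord1; have [] := Jw b.
(* In degree t = e the part itself is shown to be zero, hence the zero preimage. *)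
exists 0; first exact: mx_in0.
have [||w Jw eq_w] := acyc (f *: graded_part t v).
- by move=> a b; rewrite mxE; apply: fJ.
- by move=> a b; rewrite -scalemxAl cyc scaler0 mxE.
rewrite mul0mx; apply/rowP => a; apply: (mulfI nz_f).
rewrite [in RHS]mxE mulr0.
apply: (@dhomog_order_gt_eq0 _ _ (d + e)).
  by apply: dhomogM => //; rewrite mxE eq_te; apply: pihomogP.
have := eq_w 0 a; rewrite !mxE => /eqP; rewrite subr_eq0 => /eqP ->.
apply: is_ideal_sum => [|b _]; first exact: order_ge_is_ideal.
rewrite -(addn1 (d + e)); apply: order_geM; first exact/ordJ'/Jw.
exact/dhomog_order_ge/kdf_homog.
Qed.

End Depth.

(** * Comparing the depths of IJ and J *)

Section Powers.

Variables (K : fieldType) (n : nat).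
Local Notation S := {mpoly K[n]}.
Implicit Types (I J : S -> Prop) (f g : S).
Local Notation maxid := (@irrelevant_ideal K n).

Lemma depth_zero_ideal J : (forall f, J f -> f = 0) -> depth maxid J = None.
Proof.
move=> J0; apply/is_depthP; left => u /J0 ->.
exact: (is_ideal0 (ideal_mul_is_ideal _ _)).
Qed.

Lemma ideal_pow_expr I f k : I f -> ideal_pow I k (f ^+ k).
Proof.
by move=> If; elim: k => [//|k IHk]; rewrite exprS; apply: ideal_mulM.
Qed.

Lemma maxid_mul_order_ge J t g : (forall f, J f -> order_ge t f) ->
  ideal_mul maxid J g -> order_ge t.+1 g.
Proof.
move=> ordJ; rewrite -add1n; apply: ideal_mul_order_ge => // f.
apply: ideal_gen_min; first exact: order_ge_is_ideal.
move=> _ [i ->]; apply: dhomog_order_ge; rewrite dhomogX; exact/eqP/mdeg1.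
Qed.

(** A regular sequence on IJ gives vanishing of Koszul homology, first for IJ and then for J by
    transfer; from this a regular sequence on J of the same length is rebuilt. *)
Lemma depth_mul_le I J d : is_ideal I -> generated_in_degree d I ->
  is_ideal J -> has_linear_resolution J ->
  (exists2 f, I f & f != 0) -> (exists2 g, J g & g != 0) ->
  depth_le (depth maxid (ideal_mul I J)) (depth maxid J).
Proof.
move=> Ii genI Ji [e genJ lin] [f0 If0 nz_f0] [g0 Jg0 nz_g0].
have [f [If hom_f nz_f]] := generated_in_degree_nonzero genI If0 nz_f0.
have [g [Jg hom_g nz_g]] := generated_in_degree_nonzero genJ Jg0 nz_g0.
have ordIJ u : ideal_mul I J u -> order_ge (d + e) u.
  by apply: ideal_mul_order_ge => h; apply: generated_in_degree_order_ge.
have := depth_spec maxid J; case: (depth maxid J) => [r|_]; last first.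
  by case: (depth _ _).
move=> /= [[u Ju nmJu] _ max_r].
have bound s : regular_seq_in maxid (ideal_mul I J) s -> (size s <= r)%N.
  move=> [s_m [reg_s _]].
  have IJi := ideal_mul_is_ideal I J.
  have acyc : koszul_acyclic_above (nth 0 (mvars K n)) n J
      (ideal_mul (seq_ideal [::]) J) (size s).
    apply: (@koszul_acyclic_above_eq _ _ _ _ (fun u => u = 0)).
      move=> h; split=> [->|/ideal_mul_nil //].
      exact: (is_ideal0 (ideal_mul_is_ideal _ _)).
    move=> i lt_n; apply: (@koszul_acyclic_transfer _ _ _ (ideal_mul I J) d e f).
    - exact: generated_in_degree_graded genJ.
    - exact: IJi.
    - exact: ordIJ.
    - exact: hom_f.
    - exact: nz_f.
    - by move=> h; apply: ideal_mulM.
    - by move=> j; apply: lin.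
    exact: (regular_seq_koszul_acyclic IJi s_m reg_s).
  have [//|//|t [<- t_m reg_t]] := weakly_regular_extend Ji _ _ acyc.
  exact/max_r/(regular_seq_in_weakly_regular Ju nmJu t_m reg_t).
have := depth_spec maxid (ideal_mul I J); case: (depth _ _) => [a|] /=.
  by move=> [_ [s reg_s <-] _]; apply: bound.
(* Infinite depth of IJ is left to exclude. Regular sequences are bounded by r, and IJ is not its
   product with the maximal ideal: fg is nonzero of degree d + e, while that product has order above
   d + e. *)
move=> [mIJ|/(_ r.+1)[s reg_s]]; last by rewrite ltnNge bound.
have nz_fg : f * g != 0 by apply: mulf_neq0.
case/eqP: nz_fg; apply: (@dhomog_order_gt_eq0 _ _ (d + e)).
  exact: dhomogM.
by apply/(maxid_mul_order_ge ordIJ)/mIJ/ideal_mulM.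
Qed.

End Powers.

Theorem proposition1p2 (K : fieldType) (n d : nat) (I : {mpoly K[n]} -> Prop)
    (Igraded : graded_ideal I) (Igen : generated_in_degree d I)
    (k0 : nat)
    (Ilin : forall k : nat, (k0 <= k)%N ->
       has_linear_resolution (ideal_pow I k)) :
  forall k : nat, (k0 <= k)%N ->
    (0 < k)%N \/ (exists2 f, I f & f != 0) ->
    depth_le (depth (@irrelevant_ideal K n) (ideal_pow I k.+1))
             (depth (@irrelevant_ideal K n) (ideal_pow I k)).
Proof.
move=> k le_k0 nz; have [Ii _] := Igraded.
have [nzI|I0] := classic (exists2 f, I f & f != 0).
  apply: (depth_mul_le Ii Igen _ (Ilin k le_k0) nzI).
    exact: ideal_pow_is_ideal.
  have [f If nz_f] := nzI; exists (f ^+ k); first exact: ideal_pow_expr.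
  exact: expf_neq0.
(* For I = 0 the positive powers are zero and have infinite depth. The exponent 0 must be excluded,
   since I^0 = S has finite depth while I^1 = 0 does not. *)
have k_gt0 : (0 < k)%N by case: nz.
rewrite (@depth_zero_ideal _ _ (ideal_pow I k)); first by case: (depth _ _).
case: k k_gt0 {le_k0 nz} => // k _ f; move: f.
apply: ideal_mul_min; first exact: zero_is_ideal.
move=> f g If _; have [->|nz_f] := eqVneq f 0; first by rewrite mul0r.
by case: I0; exists f.
Qed.
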